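(* Let $n,b,q\ge 1$ be integers with $n=bq$. If the uniform passport $[n,b^{q},n]$ has genus at least $2$ (that is, $\frac{n-q}{2}$ is an integer and is at least $2$), then there exists a dessin d'enfant with passport $[n,b^{q},n]$ whose automorphism group is trivial. The same statement holds for the passports $[b^{q},n,n]$ and $[n,n,b^{q}]$.
   Context: A dessin d'enfant (dessin) is a connected, finite, bipartite graph (vertices colored black and white, each edge joining a black vertex to a white vertex) embedded as a map in a connected, compact, oriented surface without boundary, so that every face is homeomorphic to a disk. Let $E$ be its set of edges and $n=|E|$. Let $x$ (resp. $y$) be the permutation of $E$ sending each edge $e$ to the next edge counterclockwise around the unique black (resp. white) vertex incident to $e$. The monodromy group is $G=\langle x,y\rangle\le \mathrm{Sym}(E)$; it acts transitively on $E$. Permutations act on the left and are composed from right to left. The cycles of $x$, $y$ and $(xy)^{-1}$ correspond to the black vertices, white vertices and faces, and the cycle lengths are their valencies. Conversely, any pair of permutations $x,y$ of an $n$-element set generating a transitive group arises in this way from a dessin. The passport of a dessin with $n$ edges is the triple $[\lambda_0,\lambda_1,\lambda_\infty]$ of partitions of $n$ given by the valencies of black vertices, white vertices and faces (equivalently the cycle types of $x$, $y$, $(xy)^{-1}$). Its genus is $g=\frac{n-(l(\lambda_0)+l(\lambda_1)+l(\lambda_\infty))}{2}+1$, where $l(\lambda)$ is the number of parts of $\lambda$; the genus is required to be a non-negative integer. The notation $b^{q}$ denotes the partition with $q$ parts all equal to $b$, and $n$ stands for $n^{1}$. A passport is uniform if it has the form $[a^{p},b^{q},c^{r}]$ with $n=pa=qb=rc$.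 The automorphism group of a dessin is the centralizer $C_{\mathrm{Sym}(E)}(G)=\{c\in \mathrm{Sym}(E)\mid cx=xc,\ cy=yc\}$ of its monodromy group in $\mathrm{Sym}(E)$. *)

(* Defs.v *)
From mathcomp Require Import all_boot all_order all_algebra all_fingroup.

Set Implicit Arguments.
Unset Strict Implicit.
Unset Printing Implicit Defensive.

Local Open Scope group_scope.

(* A dessin d'enfant is given by its rotation system: the set of edges and the
   permutations sending an edge to the next one counterclockwise around its
   black (resp. white) end.  The group action is transitive exactly when the
   graph is connected (and has an edge). *)
Record dessin : Type := Dessin {
  edge : finType;
  rot_black : {perm edge};
  rot_white : {perm edge};
  dessin_connected :
    [transitive <<[set rot_black; rot_white]>>, on [set: edge] | 'P]
}.

Definition monodromy (D : dessin) : {group {perm edge D}} :=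
  <<[set rot_black D; rot_white D]>>%G.

(* With x = rot_black D and y = rot_white D this is (xy)^-1 for right-to-left
   composition; the product of {perm _} applies its left factor first:
   (s * t) e = t (s e), whence the reversed order. *)
Definition rot_face (D : dessin) : {perm edge D} :=
  (rot_white D * rot_black D)^-1.

(* Partitions are sequences of parts in weakly decreasing order, so b^q is
   nseq q b. *)
Definition cycle_type (T : finType) (s : {perm T}) : seq nat :=
  sort geq [seq #|C| | C : {set T} in porbits s].

Record passport : Type := Passport {
  black_type : seq nat;
  white_type : seq nat;
  face_type : seq nat
}.

Definition passport_of (D : dessin) : passport :=
  Passport (cycle_type (rot_black D)) (cycle_type (rot_white D))
           (cycle_type (rot_face D)).

(* The number of edges of a passport is the common sum of its three
   partitions, read off from the first one.  The value is rational: a passport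
   need not have an integral genus. *)
Definition genus (p : passport) : rat :=
  (((sumn (black_type p))%:R
     - (size (black_type p) + size (white_type p) + size (face_type p))%N%:R) / 2
   + 1)%R.

Definition dessin_aut (D : dessin) : {group {perm edge D}} :=
  'C(monodromy D)%G.

(* Main.v *)
Require Import Defs.
From mathcomp Require Import all_boot all_order all_algebra all_fingroup.
From mathcomp Require Import zify lra.

Import GRing.Theory.

(* Start from a small pair of permutations x, y of E, with x a cycle, and
   replace each e by a chain e_0, ..., e_(l e) along which both permutations
   advance by one step, the last point of the chain being sent to the first one
   of the chain of x e, resp. y e.  Then x remains a cycle, the cycle lengths of
   y become sums of chain lengths, and the face permutation, which advances by
   two steps, is governed by the parities of the chains only.  Since the chain
   ends are exactly the points where the two permutations differ, automorphisms
   come from those of (x, y) preserving l.  Suitable x, y and l exist when q = 1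
   (E of size 3), when b is odd or q = 2 (E of size q + 2), and when b and q are
   even with q >= 4 (E of size 2q). *)

Set Implicit Arguments.
Unset Strict Implicit.
Unset Printing Implicit Defensive.

Local Open Scope group_scope.

(** * Permutations with a single cycle or with cycles of equal length *)

Definition one_cycle (T : finType) (s : {perm T}) :=
  forall u, porbit s u = [set: T].

Lemma one_cycleV (T : finType) (s : {perm T}) : one_cycle s -> one_cycle s^-1.
Proof. by move=> h u; rewrite porbitV h. Qed.

Lemma porbit_step (T : finType) (s : {perm T}) u : porbit s (s u) = porbit s u.
Proof. exact: (porbit_perm s 1). Qed.

Lemma one_cycle_porbit (T : finType) (s : {perm T}) c :
  (forall u, porbit s u = c) -> one_cycle s.
Proof.
move=> h u; apply/setP=> v; rewrite inE -eq_porbit_mem !h; exact: eqxx.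
Qed.

Lemma porbits_partition (T : finType) (s : {perm T}) :
  partition (porbits s) [set: T].
Proof.
have -> : porbits s = orbit 'P <[s]> @: [set: T].
  apply/setP=> C; apply/imsetP/imsetP=> -[u _ ->];
  by exists u; rewrite ?inE // porbitE.
by apply: orbit_partition; apply/actsP=> a _ u; rewrite !inE.
Qed.

Lemma cycle_type_uniform (T : finType) (s : {perm T}) b q :
    0 < b -> #|T| = (b * q)%N -> (forall u, #|porbit s u| = b) ->
  cycle_type s = nseq q b.
Proof.
move=> b_gt0 cardT cardO.
have cardP C : C \in porbits s -> #|C| = b by case/imsetP=> u _ ->.
have sizeP : size (cycle_type s) = q.
  rewrite size_sort size_map -cardE; apply/eqP; rewrite -(eqn_pmul2r b_gt0).
  by rewrite -(card_uniform_partition cardP (porbits_partition s)) cardsT cardT mulnC.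
rewrite -sizeP; apply/all_pred1P.
rewrite (perm_all _ (permEl (perm_sort _ _))); apply/allP=> _ /mapP[C + ->] /=.
by rewrite mem_enum => /cardP ->.
Qed.

Lemma cycle_type_one_cycle (T : finType) (s : {perm T}) :
  0 < #|T| -> one_cycle s -> cycle_type s = [:: #|T|].
Proof.
move=> T_gt0 s1; apply: (cycle_type_uniform (q := 1)) => // [|u]; first by rewrite muln1.
by rewrite s1 cardsT.
Qed.

(** * From permutations to dessins with trivial automorphism group *)

Lemma dessin_of_perms (T : finType) (x y f : {perm T}) :
    0 < #|T| -> one_cycle x \/ one_cycle y -> f * y * x = 1 ->
    (forall c, commute c x -> commute c y -> c = 1) ->
  exists D : dessin, passport_of D =
      Passport (cycle_type x) (cycle_type y) (cycle_type f)
    /\ dessin_aut D = 1%G.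
Proof.
move=> T_gt0 xy1 fyx c1.
have [Mx My] : x \in <<[set x; y]>> /\ y \in <<[set x; y]>>.
  by split; apply: mem_gen; rewrite !inE eqxx ?orbT.
have tr : [transitive <<[set x; y]>>, on [set: T] | 'P].
  have /card_gt0P[u _] := T_gt0.
  apply/imsetP; exists u; rewrite ?inE //; apply/esym/eqP; rewrite -subTset.
  by case: xy1 => /(_ u) <-; rewrite porbitE; apply: imsetS; rewrite cycle_subG.
exists (Dessin tr); split.
  rewrite /passport_of /rot_face /=; congr Passport; congr cycle_type.
  by apply: (mulIg (y * x)); rewrite mulVg mulgA.
apply/val_inj/trivgP/subsetP=> c /=; rewrite cent_gen.
by move/centP=> h; apply/set1P/c1; apply: h; rewrite !inE eqxx ?orbT.
Qed.

(** The combinatorial form of the passport [n, b^q, n]: [y * x] applies [y] first, and its inverse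
    is the face rotation, which is a single cycle exactly when [y * x] is. *)
Definition asymmetric_triple b q := exists (T : finType) (x y : {perm T}),
  [/\ #|T| = (b * q)%N, forall u, #|porbit y u| = b, one_cycle x, one_cycle (y * x)
    & forall c, commute c x -> commute c y -> c = 1].

(* If f y x = 1 then also x f y = y x f = 1: rotating the triple permutes the
   three entries of the passport without changing the group. *)
Lemma asymmetric_triple_dessins n b q :
    0 < n -> n = (b * q)%N -> asymmetric_triple b q ->
  let realizable p :=
    exists D : dessin, passport_of D = p /\ dessin_aut D = 1%G in
  [/\ realizable (Passport [:: n] (nseq q b) [:: n]),
      realizable (Passport (nseq q b) [:: n] [:: n])
    & realizable (Passport [:: n] [:: n] (nseq q b))].
Proof.
move=> n_gt0 nE [T [x [y [cardT yO x1 yx1 c1]]]] realizable.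
have b_gt0 : 0 < b by move: n_gt0; rewrite nE muln_gt0 => /andP[].
have T_gt0 : 0 < #|T| by rewrite cardT -nE.
have f1 := one_cycleV yx1.
have fyx : (y * x)^-1 * y * x = 1 by rewrite -mulgA mulVg.
have xfy : x * (y * x)^-1 * y = 1 by rewrite invMg !mulgA mulgV mul1g mulVg.
have yxf : y * x * (y * x)^-1 = 1 by rewrite mulgV.
have cf c : commute c (y * x)^-1 -> commute c (y * x).
  by move/commuteV; rewrite invgK.
have one s := cycle_type_one_cycle (s := s) T_gt0.
have yT := cycle_type_uniform b_gt0 cardT yO.
split.
- have [|D [pD aD]] := dessin_of_perms T_gt0 _ fyx c1; first by left.
  by exists D; rewrite pD yT !one // cardT -nE.
- have [||D [pD aD]] := dessin_of_perms T_gt0 _ xfy; first by right.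
    move=> c cy /cf cyx; apply: c1 => //.
    by rewrite -(mulKg y x); apply: commuteM => //; apply: commuteV.
  by exists D; rewrite pD yT !one // cardT -nE.
have [||D [pD aD]] := dessin_of_perms T_gt0 _ yxf; first by left.
  move=> c /cf cyx cx; apply: c1 => //.
  by rewrite -(mulgK x y); apply: commuteM => //; apply: commuteV.
by exists D; rewrite pD yT !one // cardT -nE.
Qed.

(** * Replacing points by chains *)

Section Chain.

Variables (E : finType) (l : E -> nat).

Definition chain := {e : E & 'I_(l e).+1}.

(** A natural number as position avoids dependent indices; [inord] sends an out-of-range [j] to 0,
    hence the bounds [j <= l e] below. *)
Definition link (e : E) (j : nat) : chain :=
  Tagged (fun e => 'I_(l e).+1) (inord j : 'I_(l e).+1).

Lemma linkP (u : chain) : exists e j, j <= l e /\ u = link e j.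
Proof.
by case: u => e j; exists e, j; split; [rewrite -ltnS | rewrite /link inord_val].
Qed.

Lemma link_inj e j e' j' : j <= l e -> j' <= l e' ->
  link e j = link e' j' -> e = e' /\ j = j'.
Proof.
move=> hj hj' h; have ee' : e = e' by exact: (congr1 tag h).
split=> //; case: _ / ee' h hj' => h hj'.
by move/eqP: h; rewrite eq_Tagged /= => /eqP/(congr1 val); rewrite /= !inordK.
Qed.

Definition chain_step (s : E -> E) (u : chain) : chain :=
  if tagged u < l (tag u) then link (tag u) (tagged u).+1 else link (s (tag u)) 0.

Lemma chain_stepE (s : E -> E) e j : j <= l e ->
  chain_step s (link e j) = if j < l e then link e j.+1 else link (s e) 0.
Proof. by move=> hj; rewrite /chain_step /= inordK. Qed.

Lemma chain_step_inj (s : {perm E}) : injective (chain_step s).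
Proof.
move=> u v; have [e [j [hj ->]]] := linkP u; have [e' [j' [hj' ->]]] := linkP v.
rewrite !chain_stepE //; case: ltnP => h; case: ltnP => h' /link_inj.
- by case=> // -> [->].
- by case.
- by case.
case=> // /perm_inj ee' _; case: _ / ee' in hj' h' *.
by congr link; apply/eqP; rewrite eqn_leq (leq_trans hj) // (leq_trans hj').
Qed.

Definition chain_perm (s : {perm E}) : {perm chain} := perm (@chain_step_inj s).

Lemma chain_perm_next (s : {perm E}) e j :
  j < l e -> chain_perm s (link e j) = link e j.+1.
Proof. by move=> h; rewrite permE chain_stepE ?h // ltnW. Qed.

Lemma chain_perm_last (s : {perm E}) e : chain_perm s (link e (l e)) = link (s e) 0.
Proof. by rewrite permE chain_stepE // ltnn. Qed.

Lemma porbit_chain_head (s : {perm E}) e j : j <= l e ->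
  porbit (chain_perm s) (link e j) = porbit (chain_perm s) (link e 0).
Proof.
elim: j => // j IH h.
by rewrite -(chain_perm_next s h) porbit_step IH // ltnW.
Qed.

(** A step either keeps the tag or applies [s] to it; conversely, every chain is run through from
    its head to its end and then left for the head of the chain of its image under [s]. *)
Lemma porbit_chain_perm (s : {perm E}) (u : chain) :
  porbit (chain_perm s) u = [set v | tag v \in porbit s (tag u)].
Proof.
have [e0 [j0 [h0 ->]]] := linkP u; rewrite porbit_chain_head //=.
apply/eqP; rewrite eqEsubset; apply/andP; split; apply/subsetP=> v.
  case/porbitP=> i ->; elim: i => [|i]; first by rewrite perm1 inE porbit_id.
  rewrite expgSr permM; move: ((chain_perm s ^+ i) (link e0 0)) => w; rewrite !inE.
  rewrite permE /chain_step; case: ifP => //= _.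
  by rewrite -!eq_porbit_mem porbit_step.
have [e [j [h ->]]] := linkP v; rewrite inE => e_s.
rewrite -eq_porbit_mem porbit_chain_head //; case/porbitP: e_s => i /= ->.
elim: i => [|i]; first by rewrite perm1.
rewrite expgSr permM; move: ((s ^+ i) e0) => w; rewrite eq_sym => /eqP ->.
by rewrite -chain_perm_last porbit_step porbit_chain_head.
Qed.

Lemma one_cycle_chain_perm (s : {perm E}) : one_cycle s -> one_cycle (chain_perm s).
Proof. by move=> s1 u; apply/setP=> v; rewrite porbit_chain_perm s1 !inE. Qed.

Lemma card_chain_tag (A : {set E}) :
  #|[set u : chain | tag u \in A]| = \sum_(e in A) (l e).+1.
Proof.
rewrite -sum1_card -(eq_bigl _ _ (fun u => esym (in_set _ u))).
under [RHS]eq_bigr => e _ do rewrite -[(l e).+1]card_ord -sum1_card.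
rewrite sig_big_dep /=; apply: eq_bigl => u; by rewrite inE andbT.
Qed.

Lemma card_chain : #|{: chain}| = \sum_e (l e).+1.
Proof.
rewrite -cardsT; have -> : [set: chain] = [set u : chain | tag u \in [set: E]].
  by apply/setP=> u; rewrite !inE.
by rewrite card_chain_tag; apply: eq_bigl => e; rewrite inE.
Qed.

Lemma card_porbit_chain_perm (s : {perm E}) (u : chain) :
  #|porbit (chain_perm s) u| = \sum_(e in porbit s (tag u)) (l e).+1.
Proof. by rewrite porbit_chain_perm card_chain_tag. Qed.

Variables x y : {perm E}.
Let X := chain_perm x.
Let Y := chain_perm y.
Let orb := porbit (Y * X).

(* Y * X moves two steps along a chain, so the parity of the chain decides
   through which of x, y it is left. *)
Lemma porbit_face_exit e j : j <= l e ->
  orb (link e j) = if odd (l e - j) then orb (link (x e) 0) else orb (X (link (y e) 0)).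
Proof.
(* Induction on a strict bound for [l e - j], since this distance drops by two at a time. *)
move: {2}(l e - j).+1 (ltnSn (l e - j)) => d; elim: d j => // d IH j.
rewrite ltnS => hd hj; rewrite -[LHS]porbit_step permM -/orb.
have [j_lt|] := ltnP j (l e); last first.
  move=> ?; have -> : j = l e by lia.
  by rewrite /Y chain_perm_last subnn.
rewrite /Y chain_perm_next //.
have [j1_lt|] := ltnP j.+1 (l e); last first.
  move=> ?; have jE : j.+1 = l e by lia.
  by rewrite jE /X chain_perm_last -jE subSnn.
rewrite /X chain_perm_next // IH ?(leq_trans _ hd) //; last by lia.
by have -> : odd (l e - j.+2) = odd (l e - j) by lia.
Qed.

(** These are the face orbits of the even and of the odd positions of chain [e]. If [l e = 0] there
    is no odd position, and [X (link e 0)] is the head of chain [x e]. *)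
Definition even_orbit e := orb (link e 0).
Definition odd_orbit e := orb (X (link e 0)).

Lemma even_orbitE e :
  even_orbit e = if odd (l e) then even_orbit (x e) else odd_orbit (y e).
Proof. by rewrite /even_orbit porbit_face_exit // subn0. Qed.

Lemma odd_orbitE e :
  odd_orbit e = if odd (l e) then odd_orbit (y e) else even_orbit (x e).
Proof.
rewrite /odd_orbit; have [l0|l_gt0] := posnP (l e).
  by rewrite l0 /= -[in link e 0]l0 /X chain_perm_last.
rewrite {1}/X chain_perm_next // porbit_face_exit //.
have -> : odd (l e - 1) = ~~ odd (l e) by lia.
by case: odd.
Qed.

Lemma one_cycle_face c :
  (forall e, even_orbit e = c /\ odd_orbit e = c) -> one_cycle (Y * X).
Proof.
move=> h; apply: (one_cycle_porbit (c := c)) => u.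
have [e [j [hj ->]]] := linkP u; rewrite -/orb porbit_face_exit //.
by case: ifP => _; [case: (h (x e)) | case: (h (y e))].
Qed.

(* An automorphism preserves the set of last links, as these are the points
   where X and Y differ; hence it maps chains to chains. *)
Lemma chain_aut_trivial :
    one_cycle x -> (forall e, x e != y e) ->
    (forall g : E -> E, (forall e, g (x e) = x (g e)) ->
       (forall e, g (y e) = y (g e)) -> (forall e, l (g e) = l e) ->
       exists e, g e = e) ->
  forall c, commute c X -> commute c Y -> c = 1.
Proof.
move=> x1 xy hg c cX cY.
have cXE u : c (X u) = X (c u) by rewrite -!permM cX.
have cYE u : c (Y u) = Y (c u) by rewrite -!permM cY.
have lastE e j : j <= l e -> (X (link e j) == Y (link e j)) = (j < l e).
  move=> hj; rewrite /X /Y; case: ltnP => h; first by rewrite !chain_perm_next ?eqxx.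
  have -> : j = l e by lia.
  by rewrite !chain_perm_last; apply: contraNF (xy e) => /eqP/link_inj[] // ->.
have c_last e j e' j' : j <= l e -> j' <= l e' -> c (link e j) = link e' j' ->
    (j < l e) = (j' < l e').
  by move=> hj hj' h; rewrite -!lastE // -h -cXE -cYE (inj_eq perm_inj).
pose g e := tag (c (link e 0)).
(* A head is the image under [X] of the last link of the preceding chain, and [c] preserves last
   links. *)
have c_head e : c (link e 0) = link (g e) 0.
  rewrite -[e](permKV x) -chain_perm_last -/X cXE; move: (x^-1 e) => {}e.
  have [e' [j' [hj' cE]]] := linkP (c (link e (l e))).
  have := c_last _ _ _ _ (leqnn _) hj' cE; rewrite ltnn => /esym/negbT.
  rewrite -leqNgt => ?; have jE : j' = l e' by lia.
  by rewrite /g -chain_perm_last -/X cXE cE jE /X chain_perm_last.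
have c_link e j : j <= l e -> j <= l (g e) /\ c (link e j) = link (g e) j.
  elim: j => [|j IH] hj; first by rewrite c_head.
  have [hj' cE] := IH (ltnW hj).
  have j_lt : j < l (g e) by rewrite -(c_last _ _ _ _ (ltnW hj) hj' cE).
  by split=> //; rewrite -!(chain_perm_next x) // -/X cXE cE.
have lg e : l (g e) = l e.
  have [hj cE] := c_link e _ (leqnn _).
  have := c_last _ _ _ _ (leqnn _) hj cE; rewrite ltnn => /esym/negbT.
  by rewrite -leqNgt => ?; apply/eqP; rewrite eqn_leq hj andbT.
have g_step (s : {perm E}) e : (forall u, c (chain_perm s u) = chain_perm s (c u)) ->
    g (s e) = s (g e).
  move=> cs; rewrite {1}/g -chain_perm_last cs.
  by rewrite (c_link e _ (leqnn _)).2 -lg chain_perm_last.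
have [e ge] := hg g (fun e => g_step x e cXE) (fun e => g_step y e cYE) lg.
(* [c] fixes the head of chain [e]; as it commutes with the transitive [X], it fixes every point. *)
apply/permP=> u; rewrite perm1.
have : u \in porbit X (link e 0) by rewrite /X one_cycle_chain_perm ?inE.
case/porbitP=> i ->; rewrite -permM.
have -> : X ^+ i * c = c * X ^+ i by symmetry; apply: commuteX.
by rewrite permM c_head ge.
Qed.

End Chain.

Lemma chain_triple (E : finType) (l : E -> nat) (x y : {perm E}) b q c :
    \sum_e (l e).+1 = (b * q)%N ->
    (forall e, \sum_(e' in porbit y e) (l e').+1 = b) ->
    one_cycle x -> (forall e, x e != y e) ->
    (forall e, even_orbit l x y e = c /\ odd_orbit l x y e = c) ->
    (forall g : E -> E, (forall e, g (x e) = x (g e)) ->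
       (forall e, g (y e) = y (g e)) -> (forall e, l (g e) = l e) ->
       exists e, g e = e) ->
  asymmetric_triple b q.
Proof.
move=> suml sumy x1 xy face rigid.
exists (chain l), (chain_perm l x), (chain_perm l y); split.
- by rewrite card_chain.
- by move=> u; rewrite card_porbit_chain_perm.
- exact: one_cycle_chain_perm.
- exact: one_cycle_face face.
- exact: chain_aut_trivial.
Qed.

(** * A rotation and an involution on indices 0, ..., N *)

Definition rotation N : {perm 'I_N} := perm (@ordS_inj N).

Lemma one_cycle_rotation N : one_cycle (rotation N).
Proof.
case: N => [[] //|N]; apply: (one_cycle_porbit (c := porbit (rotation N.+1) ord0)) => u.
rewrite -(porbit_perm _ u ord0); congr porbit; apply/val_inj => /=.
suff -> i : i <= N -> (rotation N.+1 ^+ i) ord0 = i :> nat by rewrite // -ltnS.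
elim: i => [|i IH] hi; first by rewrite perm1.
by rewrite expgSr permM permE /= IH ?modn_small // ltnW.
Qed.

Lemma porbit_involution (T : finType) (s : {perm T}) u :
  s (s u) = u -> porbit s u = [set u; s u].
Proof.
move=> ss; apply/eqP; rewrite eqEsubset; apply/andP; split; apply/subsetP=> v.
  case/porbitP=> i ->; elim: i => [|i]; first by rewrite perm1 !inE eqxx.
  by rewrite expgSr permM !inE => /orP[] /eqP->; rewrite ?ss eqxx ?orbT.
by rewrite !inE -eq_porbit_mem => /orP[] /eqP->; rewrite ?porbit_step.
Qed.

Local Open Scope nat_scope.

(* P i and Q i stand for the face orbits of the first point of chain i and of its
   image under the chain permutation of x. *)
Lemma ord_chain_triple N (w l : nat -> nat) b q :
    let next i := if i == N then 0 else i.+1 in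
    \sum_(i < N.+1) (l i).+1 = (b * q)%N ->
    (forall i, i <= N -> w i <= N) -> (forall i, i <= N -> w (w i) = i) ->
    (forall i, i <= N -> ((l i).+1 + if w i == i then 0 else (l (w i)).+1)%N = b) ->
    (forall i, i <= N -> next i != w i) ->
    (forall (C : Type) (P Q : nat -> C), P N.+1 = P 0 ->
       (forall i, i <= N -> P i = if odd (l i) then P i.+1 else Q (w i)) ->
       (forall i, i <= N -> Q i = if odd (l i) then Q (w i) else P i.+1) ->
       forall i, i <= N -> P i = P 0 /\ Q i = P 0) ->
    (forall g : nat -> nat, (forall i, i <= N -> g i <= N) ->
       (forall i, i <= N -> g (next i) = next (g i)) ->
       (forall i, i <= N -> g (w i) = w (g i)) ->
       (forall i, i <= N -> l (g i) = l i) ->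
       exists2 i, i <= N & g i = i) ->
  asymmetric_triple b q.
Proof.
move=> next suml w_le wK sumw next_w face rigid.
have leN (i : 'I_N.+1) : i <= N by rewrite -ltnS.
pose wo (i : 'I_N.+1) : 'I_N.+1 := inord (w i).
have woE i : wo i = w i :> nat by rewrite /wo inordK // ltnS w_le.
have woK : involutive wo by move=> i; apply/val_inj; rewrite /= !woE wK.
pose x := rotation N.+1; pose y := perm (inv_inj woK).
have xE i : x i = next i :> nat.
  rewrite permE /= /next; case: eqP => [->|]; first by rewrite modnn.
  by move=> ?; rewrite modn_small //; have := leN i; lia.
have next_le i : i <= N -> next i <= N by rewrite /next; case: eqP; lia.
have yE i : y i = w i :> nat by rewrite permE woE.
have yy i : y (y i) = i by rewrite !permE woK.
have x_in i : i <= N -> x (inord i) = inord (next i).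
  by move=> hi; apply/val_inj; rewrite /= xE inordK // inordK // ltnS next_le.
(* At [i = N] the right side is out of range and [inord] defaults to [ord0], which is the wanted
   wrap-around. *)
have in_next i : i <= N -> inord (next i) = inord i.+1 :> 'I_N.+1.
  rewrite /next; case: eqP => // -> _; apply/val_inj.
  by rewrite /= inordK // /inord val_insubd ltnn.
have y_in i : i <= N -> y (inord i) = inord (w i).
  by move=> hi; apply/val_inj; rewrite /= yE inordK // inordK // ltnS w_le.
pose lo (i : 'I_N.+1) := l i.
have lo_in i : i <= N -> lo (inord i) = l i by move=> hi; rewrite /lo inordK.
apply: (@chain_triple _ lo x y _ _ (even_orbit lo x y ord0)) => //.
- move=> e; rewrite porbit_involution // -(sumw e) // -yE.
  rewrite -[_ == _ :> nat]/(y e == e); have [->|yee] := eqVneq (y e) e.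
    by rewrite setUid big_set1 addn0.
  by rewrite big_setU1 ?inE 1?eq_sym // big_set1.
- exact: one_cycle_rotation.
- by move=> e; apply: contra_neq (next_w e (leN e)) => xy; rewrite -xE -yE xy.
- move=> e; rewrite -(inord_val e) -[ord0](inord_val ord0).
  apply: (face _ (fun i => even_orbit lo x y (inord i))
            (fun i => odd_orbit lo x y (inord i))) => // [|i hi|i hi].
  - by rewrite -in_next // /next eqxx.
  - by rewrite even_orbitE lo_in // x_in // y_in // in_next.
  by rewrite odd_orbitE lo_in // x_in // y_in // in_next.
move=> g gx gy lg; have [||||i hi gi] := rigid (fun i => g (inord i)).
- by [].
- by move=> i hi; rewrite -x_in // gx xE.
- by move=> i hi; rewrite -y_in // gy yE.
- by move=> i hi; rewrite -/(lo _) lg lo_in.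
by exists (inord i); apply/val_inj; rewrite /= gi inordK.
Qed.

(** * The explicit families *)

Lemma asymmetric_triple_one_cycle b : 5 <= b -> odd b -> asymmetric_triple b 1.
Proof.
move=> b5 b_odd.
(* With [y] the inverse of [x], the chains have [b - 3], 1 and 2 points. As [b - 4] is odd, the face
   orbits coincide; as it is positive, chain 1 is the only one with a single point, so it is fixed
   by every symmetry. *)
pose l (e : 'I_3) : nat := nth 0 [:: b - 4; 0; 1] e.
pose x := rotation 3.
have xE (e : 'I_3) : x e = (e.+1 %% 3) :> nat by rewrite permE.
have x0 : x (inord 0) = inord 1 by apply/val_inj; rewrite /= xE !inordK.
have x1 : x (inord 1) = inord 2 by apply/val_inj; rewrite /= xE !inordK.
have x2 : x (inord 2) = inord 0 by apply/val_inj; rewrite /= xE !inordK.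
have y0 : x^-1 (inord 0) = inord 2 by rewrite -x2 permK.
have y1 : x^-1 (inord 1) = inord 0 by rewrite -x0 permK.
have y2 : x^-1 (inord 2) = inord 1 by rewrite -x1 permK.
have l0 : l (inord 0) = b - 4 by rewrite /l inordK.
have l1 : l (inord 1) = 0 by rewrite /l inordK.
have l2 : l (inord 2) = 1 by rewrite /l inordK.
have I3 (e : 'I_3) : [\/ e = inord 0, e = inord 1 | e = inord 2].
  have : val e \in iota 0 3 by rewrite mem_iota ltn_ord.
  by rewrite !inE => /or3P[] /eqP eE; [constructor 1 | constructor 2 | constructor 3];
     apply/val_inj; rewrite eE /= inordK.
have suml : \sum_e (l e).+1 = b.
  by rewrite !big_ord_recl big_ord0 /l /=; lia.
have b4_odd : odd (b - 4) by lia.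
have x_cycle := @one_cycle_rotation 3.
apply: (@chain_triple _ l x x^-1 _ _ (even_orbit l x x^-1 (inord 0))) => //.
- by rewrite muln1.
- move=> e; rewrite porbitV x_cycle -[RHS]suml.
  by apply: eq_bigl => e'; rewrite inE.
- by move=> e; case: (I3 e) => ->; rewrite ?(x0, x1, x2) ?(y0, y1, y2)
    -val_eqE /= !inordK.
- have P0 := even_orbitE l x x^-1 (inord 0); have Q0 := odd_orbitE l x x^-1 (inord 0).
  have P1 := even_orbitE l x x^-1 (inord 1); have Q1 := odd_orbitE l x x^-1 (inord 1).
  have P2 := even_orbitE l x x^-1 (inord 2); have Q2 := odd_orbitE l x x^-1 (inord 2).
  rewrite l0 b4_odd x0 in P0; rewrite l0 b4_odd y0 in Q0.
  rewrite l1 y1 /= in P1; rewrite l1 x1 /= in Q1.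
  rewrite l2 x2 /= in P2; rewrite l2 y2 /= in Q2.
  by move=> e; case: (I3 e) => ->; split; congruence.
move=> g _ _ lg; exists (inord 1); have := lg (inord 1); rewrite l1.
by case: (I3 (g (inord 1))) => -> //; rewrite ?l0 ?l2 //; lia.
Qed.

(* y = (0 2)(1 3), with chains of 1, 1, b - 1, b - 1, b, ..., b points. *)
Lemma asymmetric_triple_odd b q :
  3 <= b -> 2 <= q -> odd b || (q == 2) -> asymmetric_triple b q.
Proof.
move=> b3 q2 bq.
pose w i := match i with 0 => 2 | 1 => 3 | 2 => 0 | 3 => 1 | _ => i end.
pose l i := match i with 0 | 1 => 0 | 2 | 3 => b - 2 | _ => b - 1 end.
apply: (@ord_chain_triple q.+1 w l).
- have -> : q.+2 = 4 + (q - 2) by lia.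
  rewrite big_split_ord /= !big_ord_recl big_ord0 sum_nat_const card_ord /l /=; nia.
- by case=> [|[|[|[|i]]]] h; rewrite /w //; lia.
- by case=> [|[|[|[|i]]]].
- by case=> [|[|[|[|i]]]] _; rewrite /w /l /= ?eqxx; lia.
- move=> i _; apply/eqP; case: ifP => /eqP; rewrite /w.
    by case: i => [|[|[|[|i]]]]; lia.
  by case: i => [|[|[|[|i]]]]; lia.
- move=> C P Q Pq hP hQ.
  (* For [q = 2] the range of [i] is empty, so [b] may be even there. *)
  have b1 i : 4 <= i -> i <= q.+1 -> odd (b - 1) = false by case/orP: bq; lia.
  (* Such chains are fixed by [w] and have [l i] even, so P i = Q i = P (i + 1); the induction
     descends from [q.+2], where P returns to [P 0]. *)
  have P4 i : 4 <= i -> i <= q.+2 -> P i = P 0.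
    move=> i4; elim: (q.+2 - i) {-2}i (leqnn (q.+2 - i)) i4 => [|d IH] {}i hd i4 hi.
      by have -> : i = q.+2 by lia.
    have [->//|iq] := eqVneq i q.+2.
    have := hQ i; have := hP i; move: i4 hd hi iq; case: i => [|[|[|[|i]]]] //.
    move=> i4 hd hi iq; rewrite /l /w (b1 i.+4) //; last by lia.
    move=> ->; last by lia.
    by move=> -> ; [apply: IH; lia | lia].
  have [le2 le3] : 2 <= q.+1 /\ 3 <= q.+1 by lia.
  have P0 := hP 0 isT; have P1 := hP 1 isT; have P2 := hP 2 le2; have P3 := hP 3 le3.
  have Q0 := hQ 0 isT; have Q1 := hQ 1 isT; have Q2 := hQ 2 le2; have Q3 := hQ 3 le3.
  have PQ4 : P 4 = P 0 by apply: P4.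
  rewrite /l /w /= in P0 P1 P2 P3 Q0 Q1 Q2 Q3.
  case=> [|[|[|[|i]]]] hi; try by case: odd P2 P3 Q2 Q3; split; congruence.
  have i4 : 4 <= i.+4 by [].
  by rewrite (P4 i.+4 i4 (leqW hi)) hQ // /l (b1 i.+4) ?P4.
(* Only chains 0 and 1 have [l] equal to 0, so [g] maps both into {0, 1}; [g 0 = 1] would give
   [g 1 = 2]. *)
move=> g g_le g_next _ lg; exists 0 => //.
have l0 := lg 0 isT; have l1 := lg 1 isT; rewrite /l in l0 l1.
have := g_next 0 isT; case: (g 0) l0 => [|[|[|[|i]]]] //=; try lia.
by case: eqP => [|_]; [lia | move=> /= _ g1; rewrite g1 in l1; lia].
Qed.

(* y = (0 3)(1 4)(2 6)(5 7), an asymmetric one-vertex one-face gluing of the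
   octagon, followed by translates of (0 2)(1 3).  Here 2 is the only i with
   y i = x^4 i and y (x^3 i) = x^5 i. *)
Lemma asymmetric_triple_even b r :
  2 <= b -> 2 <= r -> ~~ odd b -> asymmetric_triple b (2 * r).
Proof.
move=> b2 r2 b_even.
pose w i := if i < 8 then nth 0 [:: 3; 4; 6; 0; 1; 7; 2; 5] i
            else if i %% 4 < 2 then i + 2 else i - 2.
(* Each 2-cycle of [w] gets chains of 1 and [b - 1] points. All values are even, so the face orbits
   follow the map i -> w i + 1. For [b = 2] every chain is a single point, so the asymmetry must
   come from the two permutations. *)
pose l i := if i < w i then 0 else b - 2.
have w_block k i : 2 <= k -> i < 4 ->
    w (4 * k + i) = 4 * k + nth 0 [:: 2; 3; 0; 1] i.
  move=> k2 i4; rewrite /w ifN; last by lia.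
  have -> : (4 * k + i) %% 4 = i by lia.
  by move: i i4; do 4?[case=> [|] /=; first lia].
have l_block k i : 2 <= k -> i < 4 -> l (4 * k + i) = nth 0 [:: 0; 0; b - 2; b - 2] i.
  move=> k2 i4; rewrite /l w_block // ltn_add2l.
  by move: i i4; do 4?[case=> [|] //=].
have l_even i : odd (l i) = false.
  by rewrite /l; case: ifP => _ //; rewrite oddB // (negbTE b_even).
have split8 (A : nat -> Prop) : (forall i, i < 8 -> A i) ->
    (forall k i, 2 <= k -> i < 4 -> A (4 * k + i)) -> forall i, A i.
  move=> A8 Ak i; have [/A8 //|i8] := ltnP i 8.
  have -> : i = 4 * (i %/ 4) + i %% 4 by lia.
  by apply: Ak; lia.
apply: (@ord_chain_triple (4 * r - 1) w l).
- have -> : (4 * r - 1).+1 = 4 * (r - 2 + 2) by lia.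
  have -> : b * (2 * r) = b * (2 * (r - 2 + 2)) by congr (_ * (_ * _)); lia.
  elim: (r - 2) => [|k IH]; first by rewrite !big_ord_recl big_ord0 /l /w /=; lia.
  have -> : 4 * (k.+1 + 2) = (4 * (k + 2)).+4 by lia.
  rewrite !big_ord_recr /= IH.
  have := l_block (k + 2); set m := 4 * (k + 2) => lm.
  have l0 := lm 0; rewrite addn0 in l0.
  have -> : m.+3 = m + 3 by lia.
  have -> : m.+2 = m + 2 by lia.
  have -> : m.+1 = m + 1 by lia.
  by rewrite l0 ?lm //=; nia.
- apply: split8 => [|k i k2 i4] h.
    by rewrite /w; do 8?[case: h => [|h] //=]; lia.
  by rewrite w_block //; move: i i4 h; do 4?[case=> [|] //=]; lia.
- apply: split8 => [|k i k2 i4 _]; first by do 8?[case=> [|] //].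
  by rewrite w_block //; move: i i4; do 4?[case=> [_|]; first by rewrite w_block].
- apply: split8 => [|k i k2 i4 _].
    by do 8?[case=> [|] /=; first by rewrite /l /w /=; lia].
  rewrite w_block //; move: i i4.
  do 4?[case=> [_|]; first by rewrite eqn_add2l !l_block //=; lia].
  by [].
- apply: split8 => [i i8 _|k i k2 i4 h]; apply/eqP.
    by case: ifP => /eqP; move: i i8; do 8?[case=> [|] //=]; rewrite /w /=; lia.
  by rewrite w_block //; case: ifP => /eqP; move: i i4 h; do 4?[case=> [|] //=]; lia.
- move=> C P Q _ hP hQ.
  have Pw i : i <= 4 * r - 1 -> P i = Q (w i) by move/hP; rewrite l_even.
  have Qn i : i <= 4 * r - 1 -> Q i = P i.+1 by move/hQ; rewrite l_even.
  have le8 i : i < 8 -> i <= 4 * r - 1 by lia.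
  (* The map i -> w i + 1 runs through 0, 4, 2, 7, 6, 3, 1, 5 and leaves at 8. *)
  have first8 : P 8 = P 0 /\ forall i, i < 8 -> P i = P 0 /\ Q i = P 0.
    have P0 := Pw 0 (le8 0 isT); have P1 := Pw 1 (le8 1 isT).
    have P2 := Pw 2 (le8 2 isT); have P3 := Pw 3 (le8 3 isT).
    have P4 := Pw 4 (le8 4 isT); have P5 := Pw 5 (le8 5 isT).
    have P6 := Pw 6 (le8 6 isT); have P7 := Pw 7 (le8 7 isT).
    have Q0 := Qn 0 (le8 0 isT); have Q1 := Qn 1 (le8 1 isT).
    have Q2 := Qn 2 (le8 2 isT); have Q3 := Qn 3 (le8 3 isT).
    have Q4 := Qn 4 (le8 4 isT); have Q5 := Qn 5 (le8 5 isT).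
    have Q6 := Qn 6 (le8 6 isT); have Q7 := Qn 7 (le8 7 isT).
    rewrite /w /= in P0 P1 P2 P3 P4 P5 P6 P7.
    by split; [congruence | do 8?[case=> [|] //=; first by split; congruence]].
  (* Relative to [4 * k], the face runs through 0, 3, 2, 1 and leaves at 4, the start of the next
     block. *)
  have block k : 2 <= k -> k < r -> P (4 * k + 4) = P (4 * k)
      /\ forall i, i < 4 -> P (4 * k + i) = P (4 * k) /\ Q (4 * k + i) = P (4 * k).
    move=> k2 kr; have Pk i : i < 4 ->
        P (4 * k + i) = Q (4 * k + nth 0 [:: 2; 3; 0; 1] i).
      by move=> i4; rewrite -w_block // Pw //; lia.
    have Qk i : i < 4 -> Q (4 * k + i) = P (4 * k + i.+1).
      by move=> i4; rewrite addnS Qn //; lia.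
    have P0 := Pk 0 isT; have P1 := Pk 1 isT; have P2 := Pk 2 isT; have P3 := Pk 3 isT.
    have Q0 := Qk 0 isT; have Q1 := Qk 1 isT; have Q2 := Qk 2 isT; have Q3 := Qk 3 isT.
    rewrite /= addn0 in P0 P1 P2 P3 Q0 Q1 Q2 Q3.
    split; first by congruence.
    do 4?[case=> [|] //=; first by rewrite ?addn0; split; congruence].
  have P4 k : 2 <= k -> k <= r -> P (4 * k) = P 0.
    elim: k => // k IH k1 kr; have [k2|k2] := ltnP 1 k.
      by rewrite -(IH k2 (ltnW kr)) -(block k k2 kr).1; congr P; lia.
    have -> : 4 * k.+1 = 8 by lia.
    by case: first8.
  apply: split8 => [i i8 _|k i k2 i4 h]; first by case: first8 => _; apply.
  have kr : k < r by lia.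
  by rewrite -(P4 k k2 (ltnW kr)); apply: (block k k2 kr).2.
move=> g g_le g_next gw _; exists 2; first lia.
(* Commuting with the rotation makes [g] a shift modulo [4 * r]. *)
have g_shift k : k <= 5 ->
    g (2 + k) = if g 2 + k < 4 * r then g 2 + k else g 2 + k - 4 * r.
  have g2 := g_le 2; elim: k => [|k IH] hk; first by rewrite !addn0 ifT; lia.
  have := g_next (2 + k); rewrite ifN; last by apply/eqP; lia.
  rewrite addnS => ->; last lia.
  rewrite IH; last lia.
  case: ltnP => ?; case: ltnP => ?; case: eqP; lia.
have w2 : g (2 + 4) = w (g 2) by apply: (gw 2); lia.
have w5 : g (2 + 5) = w (g (2 + 3)) by apply: (gw 5); lia.
rewrite (g_shift 4) // in w2; rewrite (g_shift 5) // (g_shift 3) // in w5.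
have a_lt : g 2 < 4 * r by have := g_le 2; lia.
(* For [a >= 8], [w a] is a + 2 or a - 2, never a + 4 modulo [4 * r], because [4 * r] is at least
   8. *)
move: (g 2) a_lt w2 w5 => a a_lt; have [a8|a8] := ltnP a 8; last first.
  have -> : w a = if a %% 4 < 2 then a + 2 else a - 2 by rewrite /w ifN // -leqNgt.
  by case: ifP => ?; case: ifP; lia.
(* For [r > 2] nothing wraps around and w a = a + 4 leaves only a = 2. For [r = 2] it also holds at
   a = 6 modulo 8, which [w5] excludes. *)
have [r3|r_le2] := ltnP 2 r.
  rewrite ifT; last by lia.
  by move=> + _; move: a a8 {a_lt}; do 8?[case=> [|] //].
have -> : r = 2 by lia.
by move: a a8 {a_lt}; do 8?[case=> [|] //].
Qed.

(** * The genus condition and the choice of family *)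

Lemma genus_ge2 (p : passport) n q :
    sumn (black_type p) = n ->
    size (black_type p) + size (white_type p) + size (face_type p) = q + 2 ->
    (genus p \is a Num.int)%R -> (2 <= genus p)%R ->
  exists2 k, 2 <= k & n = q + 2 * k.
Proof.
move=> sum_p size_p /Num.Theory.intrP[m gE] p_ge2.
have : (2%:Z <= m)%R by rewrite -(ler_int rat) -gE.
(* The witness is the genus itself: with [q + 2] parts in all, it equals (n - q) / 2. *)
case: m gE => // k gE k2; exists k => //.
move: gE; rewrite /genus sum_p size_p -pmulrn => gE.
apply/eqP; rewrite -(Num.Theory.eqr_nat rat) natrD natrM; apply/eqP.
by rewrite natrD in gE; lra.
Qed.

(** The bound on [k] gives [b >= 5] when [q = 1] and [b >= 3] when [q = 2]; an even [b] forces an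
    even [q], so the three families cover every case. *)
Lemma asymmetric_triple_exists b q k :
  1 <= q -> 2 <= k -> b * q = q + 2 * k -> asymmetric_triple b q.
Proof.
move=> q1 k2 bqk.
have b_gt1 : 1 < b by nia.
have [b_odd|b_even] := boolP (odd b).
  have [q2|q_lt2] := ltnP 1 q.
    by apply: asymmetric_triple_odd; rewrite ?b_odd //; lia.
  have -> : q = 1 by lia.
  by apply: asymmetric_triple_one_cycle => //; nia.
have q_even : ~~ odd q.
  by have := congr1 odd bqk; rewrite oddM oddD oddM (negbTE b_even) /= addbF => <-.
have [q3|q_le2] := ltnP 2 q.
  have -> : q = 2 * (q %/ 2) by lia.
  by apply: asymmetric_triple_even => //; lia.
have qE : q = 2 by lia.
by rewrite qE; apply: asymmetric_triple_odd => //; lia.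
Qed.

Theorem theorem7p6 (n b q : nat) (hn : (1 <= n)%N) (hb : (1 <= b)%N)
    (hq : (1 <= q)%N) (hnbq : n = (b * q)%N) :
  let realizable_asymmetric (p : passport) : Prop :=
    (genus p \is a Num.int)%R -> (2 <= genus p)%R ->
    exists D : dessin, passport_of D = p /\ dessin_aut D = 1%G in
  [/\ realizable_asymmetric (Passport [:: n] (nseq q b) [:: n]),
      realizable_asymmetric (Passport (nseq q b) [:: n] [:: n])
    & realizable_asymmetric (Passport [:: n] [:: n] (nseq q b))].
Proof.
move=> realizable_asymmetric.
have key p : sumn (black_type p) = n ->
    size (black_type p) + size (white_type p) + size (face_type p) = q + 2 ->
    (asymmetric_triple b q ->
       exists D : dessin, passport_of D = p /\ dessin_aut D = 1%G) ->
    realizable_asymmetric p.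
  move=> sum_p size_p realized p_int p_ge2; apply: realized.
  have [k k2 nk] := genus_ge2 sum_p size_p p_int p_ge2.
  by apply: (asymmetric_triple_exists hq k2); rewrite -hnbq.
split; apply: key => /=; rewrite ?sumn_nseq ?size_nseq ?addn0 //; try lia.
all: by case/(asymmetric_triple_dessins hn hnbq).
Qed.
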